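(* Let $F:\mathcal H\to\mathbb R$ be twice continuously differentiable, bounded from below, with $\operatorname{crit}F\neq\emptyset$, and suppose that $F$ satisfies the Łojasiewicz condition of order $2$. Let $\alpha>0$, $\beta>0$ and let $x:[0,\infty)\to\mathcal H$ be a solution of $$\ddot x(t)+\alpha\dot x(t)+\beta\nabla^2F(x(t))\dot x(t)+\nabla F(x(t))=0,$$ with $\lim_{t\to\infty}x(t)=\bar x\in\operatorname{crit}F$. Let $t_0>0$ be such that $x(t)\in\Omega$ for all $t\ge t_0$, where $\Omega$ is a neighborhood of $\bar x$ and $\mu>0$ is such that $|F(z)-F(\bar x)|\le\frac1{2\mu}\|\nabla F(z)\|^2$ for all $z\in\Omega$. Define $$Q(\alpha,\beta)=\sqrt{\big((\alpha-\mu\beta)\beta+1\big)^2-4(1-\alpha\beta)\mu\beta^2}-\mu\beta^2,$$ $$\mathcal R(\alpha,\beta)=\begin{cases}2\alpha & \text{if } \alpha<\sqrt\mu \text{ and } \beta\in\left(\frac{\alpha}{\mu},\frac1\alpha\right),\\[2pt] \dfrac{1+\alpha\beta-Q(\alpha,\beta)}{2\beta} & \text{if } \alpha>0\text{ and }\beta\in\left(0,\frac\alpha\mu\right]\cup\left[\frac1\alpha,+\infty\right),\end{cases}$$ $$C(\alpha,\beta)=\begin{cases}1-\alpha\beta & \text{if } \alpha<\sqrt\mu \text{ and } \beta\in\left(\frac{\alpha}{\mu},\frac1\alpha\right),\\[2pt] \dfrac{1+\alpha\beta+Q(\alpha,\beta)}{2} & \text{if } \alpha>0\text{ and }\beta\in\left(0,\frac\alpha\mu\right]\cup\left[\frac1\alpha,+\infty\right).\end{cases}$$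 Then for all $t\ge t_0$ $$F(x(t))-F(\bar x)\le\left(F(x(t_0))-F(\bar x)+\frac1{2C(\alpha,\beta)}\|\beta\nabla F(x(t_0))+\dot x(t_0)\|^2\right)e^{-\mathcal R(\alpha,\beta)(t-t_0)}.$$ If in addition $F(x(t))\ge F(\bar x)$ for all $t\ge t_0$, then for any $\varepsilon>0$ $$\int_{t_0}^{+\infty}e^{(\mathcal R(\alpha,\beta)-\varepsilon)t}\|\nabla F(x(t))\|^2\,dt<+\infty,$$ and in particular $\|\nabla F(x(t))\|=o\big(e^{-\frac{\mathcal R(\alpha,\beta)-\varepsilon}{2}t}\big)$ as $t\to+\infty$.
   Context: $\mathcal H$ is a real Hilbert space with inner product $\langle\cdot,\cdot\rangle$ and norm $\|\cdot\|$. $\operatorname{crit}F=\{x\in\mathcal H:\nabla F(x)=0\}$. $F$ satisfies the Łojasiewicz condition of order $q\in(1,2]$ if for every $\bar x\in\operatorname{crit}F$ there exist a set $\Omega\subset\mathcal H$ and a constant $\mu>0$ such that $|F(x)-F(\bar x)|\le\frac1{2\mu}\|\nabla F(x)\|^q$ for all $x\in\Omega$; here either $\Omega=\mathcal H$ (global), or $\Omega=B(\bar x,\delta)\cap\{F<r\}$ for some $\delta>0$, $r>0$ (local). A solution of the ODE is a twice continuously differentiable curve satisfying it for all $t\ge0$.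
   Formalization: When αβ=1 and μβ²≥2 one has C(α,β)=0 and 1/(2C) is undefined; the bound is then read in the extended reals with 1/0=+∞ and (+∞)·0=0. For C≠0 it is the inequality as written. *)

(* Defs.v *)
(* MathComp-Analysis *)
From HB Require Import structures.
From mathcomp Require Import all_boot all_order all_algebra.
From mathcomp Require Import all_classical all_reals all_analysis.
Set Implicit Arguments.
Unset Strict Implicit.
Unset Printing Implicit Defensive.
Import Order.TTheory GRing.Theory Num.Theory.
Import numFieldNormedType.Exports.
Local Open Scope classical_set_scope.
Local Open Scope ring_scope.

(* Lets the little-o notation be used at +oo. *)
Canonical pinfty_filter_on (R : numFieldType) :=
  FilterType (pinfty_nbhs R) (@proper_pinfty_nbhs R).

(* A real Hilbert space is a complete normed space H together with an inner
   product ip satisfying hilbert_norm ip. *)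
Definition hilbert_norm (R : realType) (H : completeNormedModType R)
    (ip : {dot H for idfun}) : Prop :=
  forall u : H, `|u| ^+ 2 = ip u u.

Section Gradient.
Context (R : realType) (H : completeNormedModType R) (ip : {dot H for idfun}).
Implicit Types F : H -> R.

(* The Riesz representative of the Frechet derivative 'd F z; it exists and is
   unique as soon as F is differentiable at z. *)
Definition grad F (z : H) : H :=
  xget 0 [set g | forall h : H, 'd F z h = ip g h].

Definition crit F : set H := [set z | grad F z = 0].

Definition hessian F (z : H) : H -> H := 'd (grad F) z.

(* The last clause is continuity of the Hessian for the operator norm. *)
Definition twice_continuously_differentiable F : Prop :=
  [/\ forall z : H, differentiable F z,
      forall z : H, differentiable (grad F) z
    & forall (z : H) (e : R), 0 < e ->
        \forall y \near z, forall h : H,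
          `|hessian F y h - hessian F z h| <= e * `|h| ].

(* Used for q in ]1, 2]. The two disjuncts are the global and the local form. *)
Definition lojasiewicz F (q : R) : Prop :=
  forall xbar : H, crit F xbar ->
  exists (Omega : set H) (mu : R),
    [/\ 0 < mu,
        Omega = setT \/
        (exists delta r : R, [/\ 0 < delta, 0 < r &
           Omega = ball xbar delta `&` [set z | F z < r]])
      & forall z : H, Omega z ->
          `|F z - F xbar| <= (2 * mu)^-1 * `|grad F z| `^ q].

End Gradient.

(* Curves on [0, +oo[ are functions on R whose values on negative reals are
   irrelevant: every limit is taken within [0, +oo[, so that the derivative
   is one-sided at 0. *)
Section Curves.
Context (R : realType) (H : completeNormedModType R).
Implicit Types x : R -> H.

Definition halfline_quotient x (t : R) : R -> H :=
  fun s => (s - t)^-1 *: (x s - x t).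

Definition halfline_derivable x (t : R) : Prop :=
  cvg (halfline_quotient x t s @[s --> within `[0, +oo[ t^']).

Definition halfline_derive x (t : R) : H :=
  lim (halfline_quotient x t s @[s --> within `[0, +oo[ t^']).

Definition halfline_C2 x : Prop :=
  [/\ forall t : R, 0 <= t -> halfline_derivable x t,
      forall t : R, 0 <= t -> halfline_derivable (halfline_derive x) t
    & {within `[0, +oo[, continuous (halfline_derive (halfline_derive x))}].

End Curves.

Definition is_solution (R : realType) (H : completeNormedModType R)
    (ip : {dot H for idfun}) (F : H -> R) (alpha beta : R) (x : R -> H) : Prop :=
  halfline_C2 x /\
  forall t : R, 0 <= t ->
    halfline_derive (halfline_derive x) t
    + alpha *: halfline_derive x t
    + beta *: hessian ip F (x t) (halfline_derive x t)
    + grad ip F (x t) = 0.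

Section Rates.
Context (R : realType).
Implicit Types mu alpha beta : R.

Definition rateQ mu alpha beta : R :=
  Num.sqrt (((alpha - mu * beta) * beta + 1) ^+ 2
            - 4 * (1 - alpha * beta) * mu * beta ^+ 2)
  - mu * beta ^+ 2.

(* For alpha, beta, mu > 0, the negation of this condition is
   beta \in ]0, alpha / mu] or beta \in [alpha^-1, +oo[, because
   alpha / mu < alpha^-1 forces alpha < sqrt mu. *)
Definition weakly_damped mu alpha beta : bool :=
  (alpha < Num.sqrt mu) && (beta \in `]alpha / mu, alpha^-1[).

Definition rateR mu alpha beta : R :=
  if weakly_damped mu alpha beta then 2 * alpha
  else (1 + alpha * beta - rateQ mu alpha beta) / (2 * beta).

Definition rateC mu alpha beta : R :=
  if weakly_damped mu alpha beta then 1 - alpha * beta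
  else (1 + alpha * beta + rateQ mu alpha beta) / 2.

End Rates.

(* Main.v *)
Require Import Defs.
From HB Require Import structures.
From mathcomp Require Import all_boot all_order all_algebra.
From mathcomp Require Import all_classical all_reals all_analysis.
From mathcomp Require Import measurable_realfun ring lra.
Set Implicit Arguments.
Unset Strict Implicit.
Unset Printing Implicit Defensive.
Import Order.TTheory GRing.Theory Num.Theory.
Import numFieldNormedType.Exports.
Local Open Scope classical_set_scope.
Local Open Scope ring_scope.

(** Write [w = grad F (x t)], [V = F (x t) - F xbar] and [y = beta *: w + x'].
    In the variable [y] the Hessian-driven damping disappears:
    [y' = - alpha *: y - (1 - alpha * beta) *: w], while
    [V' = <w, y> - beta * |w|^2].  Hence, for [M > 0], the energy
    [V + M / 2 * |y|^2] has a derivative that is a quadratic form in [(w, y)]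
    with constant coefficients.

    The Lojasiewicz inequality [V <= |w|^2 / (2 * mu)] turns [R * V] into a
    multiple of [|w|^2], so that [energy' + R * energy <= 0] follows as soon as a
    binary quadratic form is nonnegative.  The constants [C] and [R] achieve
    this for [M = 1 / C]: the off-diagonal coefficient vanishes in the weakly
    damped regime, and otherwise [R] is the smaller of the two rates at which the
    discriminant vanishes, when [C] is tied to [R] by
    [C + beta * R = 1 + alpha * beta] ([rate_form_ge0]).  Gronwall's
    lemma then gives the bound on [V] ([potential_decay]).  When [C = 0] one has
    [alpha * beta = 1], and the right-hand side is infinite unless [y t0 = 0]; in
    that case [y] vanishes from [t0] on, [x] follows a gradient flow, and [V] can
    be estimated alone ([potential_decay0]).

    For the second part take [0 <= r < R].  Below the critical rate the same form
    is strictly definite, with a large [M] when [C = 0] ([strict_dissipation]), so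
    that [energy' + r * energy <= - c * (|w|^2 + |y|^2)].  As [x] converges to [xbar], the
    Hessian is bounded along the end of the trajectory, so the derivative of
    [|w|^2] is [O(|w|^2 + |y|^2)], and adding a small multiple of [|w|^2] to the
    energy keeps it decaying at the rate [r].  Since [V >= 0], this bounds
    [|w|^2] itself by [K * exp (- r * t)] ([gradient_decay]).  Integrability and
    the little-o estimate both follow from this pointwise bound.

    The identity [V' = <w, x'>] requires that the gradient represent the
    differential, that is, Riesz's theorem ([riesz]). *)

(** * Inner products and Riesz representation *)

Section InnerProduct.
Context (R : realType) (H : completeNormedModType R) (ip : {dot H for idfun}).
Context (ip_norm : hilbert_norm ip).
Implicit Types (u v : H) (t : R).

Lemma ipC u v : ip u v = ip v u.
Proof. by rewrite hermC expr0 mul1r. Qed.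

Lemma ipDl u1 u2 v : ip (u1 + u2) v = ip u1 v + ip u2 v.
Proof. by rewrite linearDl. Qed.

Lemma ipDr u v1 v2 : ip u (v1 + v2) = ip u v1 + ip u v2.
Proof. by rewrite linearDr. Qed.

Lemma ipZl (k : R) u v : ip (k *: u) v = k * ip u v.
Proof. by rewrite linearZl_LR. Qed.

Lemma ipZr (k : R) u v : ip u (k *: v) = k * ip u v.
Proof. by rewrite ipC ipZl ipC. Qed.

Lemma ipNr u v : ip u (- v) = - ip u v.
Proof. by rewrite -scaleN1r ipZr mulN1r. Qed.

Lemma normD_sqr u v : `|u + v| ^+ 2 = `|u| ^+ 2 + 2 * ip u v + `|v| ^+ 2.
Proof. by rewrite !ip_norm ipDl !ipDr (ipC v u); ring. Qed.

Lemma ip_le_norm u v : ip u v <= `|u| * `|v|.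
Proof.
have : `|u + v| ^+ 2 <= (`|u| + `|v|) ^+ 2.
  by rewrite ler_pXn2r ?nnegrE ?addr_ge0// ler_normD.
rewrite normD_sqr; lra.
Qed.

Lemma ip_sqr_le u v : ip u v ^+ 2 <= `|u| ^+ 2 * `|v| ^+ 2.
Proof.
rewrite -exprMn -[leLHS]real_normK ?num_real// ler_pXn2r ?nnegrE ?mulr_ge0//.
rewrite ler_norml ip_le_norm andbT lerNl -ipNr.
by apply: le_trans (ip_le_norm _ _) _; rewrite normrN.
Qed.

Lemma ip_polarization u v : ip u v = 4^-1 * (`|u + v| ^+ 2 - `|u - v| ^+ 2).
Proof. by rewrite !normD_sqr normrN ipNr; field. Qed.

Lemma cvg_ip (T : Type) (G : set_system T) (FG : Filter G) (f g : T -> H) u v :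
  f @ G --> u -> g @ G --> v -> ip (f x) (g x) @[x --> G] --> ip u v.
Proof.
move=> fu gv; rewrite ip_polarization.
under eq_fun do rewrite ip_polarization.
apply: cvgMr; apply: cvgB; rewrite expr2; under eq_fun do rewrite expr2.
  by apply: cvgM; apply: cvg_norm; exact: cvgD.
by apply: cvgM; apply: cvg_norm; exact: cvgB.
Qed.

(** By bilinearity the difference quotient of [`|f s| ^+ 2] is the inner product
    of [f s + f t] with the difference quotient of [f]. *)
Lemma is_derive_norm_sqr (f : R -> H) t df :
  is_derive t 1 f df -> is_derive t 1 (fun s => `|f s| ^+ 2) (2 * ip (f t) df).
Proof.
move=> [fd <-].
have ft : {for t, continuous f}.
  exact/differentiable_continuous/derivable1_diffP.
have q : h^-1 *: (`|f (h *: 1 + t)| ^+ 2 - `|f t| ^+ 2) @[h --> 0^'] -->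
    2 * ip (f t) ('D_1 f t).
  have -> : 2 * ip (f t) ('D_1 f t) = ip (f t + f t) ('D_1 f t).
    by rewrite ipDl; ring.
  rewrite (_ : (fun h => _) = (fun h : R =>
      ip (f (h *: 1 + t) + f t) (h^-1 *: (f (h *: 1 + t) - f t)))); last first.
    apply/funext => h; rewrite ipZr /GRing.scale/=; congr (_ * _).
    by rewrite !ip_norm ipDl !ipDr !ipNr (ipC (f t) (f _)); ring.
  apply: cvg_ip; last exact: fd.
  apply: cvgD; last exact: cvg_cst.
  apply: (@cvg_comp _ _ _ _ f _ (nbhs t)); last exact: ft.
  apply: cvg_within_filter.
  have : (h *: (1 : R) + t) @[h --> (0 : R)] --> 0 *: (1 : R) + t.
    by apply: cvgD; [apply: cvgZr_tmp; exact: cvg_id|exact: cvg_cst].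
  by rewrite scale0r add0r.
by split; [apply/cvg_ex; eexists; exact: q | exact: (cvg_lim _ q)].
Qed.

(** Riesz representation.  The representative of [f] is the minimiser of
    [`|h| ^+ 2 / 2 - f h]: a minimising sequence is Cauchy by the parallelogram
    law, and the first variation at the minimum is [ip g h - f h]. *)
Lemma riesz (f : {linear H -> R}) :
  continuous f -> exists g, forall h, f h = ip g h.
Proof.
move=> fc; pose J (h : H) : R := `|h| ^+ 2 / 2 - f h.
have [M fM] : exists M, forall h, `|f h| <= M * `|h|.
  have /linear_boundedP fb : bounded_near f (nbhs 0).
    exact/linear_bounded_continuous.
  by near +oo_R => M; exists M; near: M; exact: fb.
have Jlb : has_lbound (range J).
  exists (- (M ^+ 2 / 2)) => _ [h _ <-]; rewrite /J.
  have := fM h; rewrite ler_norml => /andP[_].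
  have := sqr_ge0 (`|h| - M); nra.
have J0 : range J !=set0 by exists (J 0), 0.
pose m := inf (range J).
have mJ h : m <= J h by apply: ge_inf => //; exists h.
have /choice[a am] : forall n : nat, exists h, J h < m + n.+1%:R^-1.
  move=> n; have [|_ [h _ <-] ?] := @inf_adherent _ (range J) n.+1%:R^-1 _ (conj J0 Jlb).
  - by rewrite invr_gt0.
  - by exists h.
have Jpar u v : `|u - v| ^+ 2 = 4 * (J u + J v - 2 * J (2^-1 *: (u + v))).
  have fZ : f (2^-1 *: (u + v)) = 2^-1 * (f u + f v) by rewrite linearZ linearD.
  rewrite /J fZ normrZ exprMn !normD_sqr ipNr normrN.
  by rewrite ger0_norm ?invr_ge0//; field.
have acvg : cvg (a @ \oo).
  apply/cauchy_cvgP; apply: cauchy_exP => e e0.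
  have [N _ aN] : \forall n \near \oo, n.+1%:R^-1 < e ^+ 2 / 8.
    by apply: near_infty_natSinv_lt (PosNum _); rewrite divr_gt0 ?exprn_gt0.
  (* [Jpar] bounds the distance of two near-minimisers because [J] is at least
     [m] at their midpoint. *)
  exists (a N); exists N => // n /= Nn; rewrite -ball_normE /=.
  rewrite -(@ltr_pXn2r _ 2) ?nnegrE// ?ltW// Jpar.
  have /= := aN N (leqnn N); have /= := aN n Nn; have := am N; have := am n.
  have := mJ (2^-1 *: (a N + a n)).
  move: (J _) (J _) (J _) n.+1%:R^-1 N.+1%:R^-1 (e ^+ 2) => *; lra.
pose g := lim (a @ \oo).
have Jc : J (a n) @[n --> \oo] --> J g.
  apply: cvgB; last exact: (cvg_comp _ _ acvg (fc g)).
  apply: cvgMr_tmp; rewrite expr2; under eq_fun do rewrite expr2.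
  by apply: cvgM; apply: cvg_norm.
have Jg : J g <= m.
  apply/ler_addgt0Pr => e e0; rewrite -(cvg_lim _ Jc)//.
  apply: limr_le; first by apply/cvg_ex; eexists; exact: Jc.
  have : \forall n \near \oo, n.+1%:R^-1 < e.
    exact: near_infty_natSinv_lt (PosNum e0).
  apply: filterS => n ne; apply: ltW; apply: lt_trans (am n) _.
  by rewrite ltrD2l.
exists g => h; apply/esym/eqP; rewrite -subr_eq0; set d := _ - _.
have var s : 0 <= s * d + s ^+ 2 * `|h| ^+ 2 / 2.
  have fE : f (g + s *: h) = f g + s * f h by rewrite linearD linearZ.
  have := le_trans Jg (mJ (g + s *: h)).
  rewrite /J fE normD_sqr ipZr normrZ exprMn real_normK ?num_real// /d; lra.
(* This step minimises the variation up to the [+ 1] that keeps the denominator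
   away from zero; the value there is a negative multiple of [d ^+ 2]. *)
have := var (- d / (`|h| ^+ 2 + 1)).
set p := `|h| ^+ 2; have p0 : 0 <= p by exact: exprn_ge0.
have -> : - d / (p + 1) * d + (- d / (p + 1)) ^+ 2 * p / 2 =
    - (d ^+ 2 * ((p + 2) / (2 * (p + 1) ^+ 2))).
  by field; lra.
rewrite oppr_ge0 => dp; rewrite -sqrf_eq0 eq_le sqr_ge0 andbT.
rewrite -(pmulr_lle0 _ (_ : 0 < (p + 2) / (2 * (p + 1) ^+ 2)))//.
by rewrite divr_gt0 ?mulr_gt0 ?exprn_gt0//; lra.
Unshelve. all: by end_near.
Qed.

End InnerProduct.

(** * Gradients, curves and Gronwall's inequality *)

Section Derivatives.
Context (R : realType) (H : completeNormedModType R) (ip : {dot H for idfun}).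
Context (ip_norm : hilbert_norm ip).
Implicit Types (F : H -> R) (x : R -> H) (t : R).

Lemma ip_grad F z h : differentiable F z -> 'd F z h = ip (grad ip F z) h.
Proof.
move=> dF; have [g gE] := riesz ip_norm (diff_continuous dF).
exact: (@xgetPex _ 0 [set g | forall h, 'd F z h = ip g h] (ex_intro _ g gE)).
Qed.

Lemma is_derive_along (W : normedModType R) (f : H -> W) x t dx :
  differentiable f (x t) -> is_derive t 1 x dx ->
  is_derive t 1 (f \o x) ('d f (x t) dx).
Proof.
move=> df [xd <-]; have xd' : differentiable x t by exact/derivable1_diffP.
have fxd : differentiable (f \o x) t by exact: differentiable_comp.
split; first exact/derivable1_diffP.
by rewrite !deriveE// diff_comp.
Qed.

(** A neighbourhood of an interior point lies in [`[0, +oo[], so the restriction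
    to the half-line is invisible there. *)
Lemma halfline_is_derive x t :
  0 < t -> halfline_derivable x t -> is_derive t 1 x (halfline_derive x t).
Proof.
move=> t0 xd.
have sh : (h *: (1 : R) + t) @[h --> 0^'] --> within `[0, +oo[ t^'.
  move=> P; rewrite /within /= => tP.
  have cs : (h *: (1 : R) + t) @[h --> (0 : R)] --> t.
    rewrite -[X in _ --> X](add0r t) -[X in _ --> X + t](scale0r (1 : R)).
    by apply: cvgD; [apply: cvgZr_tmp; exact: cvg_id|exact: cvg_cst].
  change (\forall h \near (0 : R), h != 0 -> P (h *: (1 : R) + t)).
  have Qt : \forall h \near (0 : R), 0 < h *: (1 : R) + t := cs _ (lt_nbhsr t0).
  have Pt : \forall h \near (0 : R), h *: (1 : R) + t != t ->
      h *: (1 : R) + t \in `[0, +oo[ -> P (h *: (1 : R) + t) := cs _ tP.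
  near=> h => h0; apply: (near Pt h) => //; last first.
    by rewrite in_itv/= andbT ltW//; exact: (near Qt h).
  by rewrite -subr_eq0 addrK scaler_eq0 negb_or h0 oner_neq0.
have q : h^-1 *: (x (h *: 1 + t) - x t) @[h --> 0^'] --> halfline_derive x t.
  rewrite (_ : (fun h => _) =
      halfline_quotient x t \o (fun h : R => h *: (1 : R) + t)).
    exact: cvg_comp sh xd.
  by apply/funext => h; rewrite /halfline_quotient/= addrK /GRing.scale/= mulr1.
by split; [apply/cvg_ex; eexists; exact: q | exact: (cvg_lim _ q)].
Unshelve. all: by end_near.
Qed.

(** The Hessian at [z] is a bounded operator, being a differential, and nearby
    Hessians differ from it by at most [1] in operator norm. *)
Lemma hessian_bounded_near F (z : H) :
  twice_continuously_differentiable ip F ->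
  exists L, 0 <= L /\
    \forall y \near z, forall h, `|hessian ip F y h| <= L * `|h|.
Proof.
move=> [_ d2 ch].
have [M [M0 fM]] : exists M, 0 <= M /\ forall h, `|hessian ip F z h| <= M * `|h|.
  have gc : continuous ('d (grad ip F) z) by exact/diff_continuous.
  have /linear_boundedP fb := (linear_bounded_continuous _).2 gc.
  near +oo_R => M; exists M; split; first by [].
  by near: M; exact: fb.
exists (M + 1); split; first by rewrite addr_ge0.
have := ch z 1 ltr01; apply: filterS => y yz h.
rewrite -(subrK (hessian ip F z h) (hessian ip F y h)).
by rewrite (le_trans (ler_normD _ _))// mulrDl addrC lerD.
Unshelve. all: by end_near.
Qed.

(** The integrating factor [expR (r * t)] turns the differential inequality into
    the monotonicity of a single function. *)
Lemma gronwall_decay (E dE : R -> R) (r a : R) :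
  (forall t, a <= t -> is_derive t 1 E (dE t)) ->
  (forall t, a <= t -> dE t + r * E t <= 0) ->
  forall t, a <= t -> E t <= E a * expR (- r * (t - a)).
Proof.
move=> Ed Ele t at0.
pose G s := expR (r * s) * E s.
have Gd s : a <= s -> is_derive s 1 G (expR (r * s) * (dE s + r * E s)).
  move=> /Ed Eds.
  have ed : is_derive s 1 (fun u => expR (r * u)) (expR (r * s) * (r * 1)).
    exact: is_derive1_comp.
  have Gd : is_derive s 1 G _ := is_deriveM ed Eds.
  by apply: is_derive_eq Gd _; rewrite /GRing.scale/=; ring.
have : G t <= G a.
  apply: (@ler0_derive1_le_cc _ G a t).
  - by move=> s; rewrite in_itv/= => /andP[/ltW /Gd []].
  - move=> s; rewrite in_itv/= => /andP[/ltW as_ _].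
    rewrite derive1E; have [_ ->] := Gd _ as_.
    by rewrite mulr_ge0_le0 ?expR_ge0// Ele.
  - apply: derivable_within_continuous => s; rewrite in_itv/= => /andP[as_ _].
    by have [] := Gd _ as_.
  - by rewrite in_itv/= at0 lexx.
  - by rewrite in_itv/= at0 lexx.
  - exact: at0.
rewrite /G mulNr mulrBr opprB expRD expRN => le.
by rewrite mulrA -ler_pdivrMr ?invr_gt0 ?expR_gt0// invrK mulrC (mulrC (E a)).
Qed.

End Derivatives.

(** * The dissipation form and the optimal rates *)

Section Rates.
Context (R : realType).
Implicit Types a b k p q r s mu : R.

(** Semidefiniteness of a binary quadratic form in two vectors, of which only the
    squared norms [p], [r] and the inner product [s] appear; the hypothesis on [s]
    is Cauchy-Schwarz. *)
Lemma form_ge0 a b k p r s : 0 <= a -> 0 <= b -> 0 <= p -> 0 <= r ->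
  k ^+ 2 <= 4 * a * b -> s ^+ 2 <= p * r -> k * s <= a * p + b * r.
Proof.
move=> a0 b0 p0 r0 kab spr.
have ap0 : 0 <= a * p by exact: mulr_ge0.
have br0 : 0 <= b * r by exact: mulr_ge0.
have : (k * s) ^+ 2 <= (a * p + b * r) ^+ 2.
  have : k ^+ 2 * s ^+ 2 <= 4 * a * b * (p * r) by rewrite ler_pM ?sqr_ge0.
  rewrite exprMn; have := sqr_ge0 (a * p - b * r); nra.
move=> h; rewrite leNgt; apply/negP => lt; move: h.
by apply/negP; rewrite -ltNge; nra.
Qed.

Section Fixed.
Context (mu alpha beta : R).
Context (mu_gt0 : 0 < mu) (alpha_gt0 : 0 < alpha) (beta_gt0 : 0 < beta).

Let beta_neq0 : beta != 0. Proof. by rewrite gt_eqF. Qed.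
Let mu_neq0 : mu != 0. Proof. by rewrite gt_eqF. Qed.
Let a := alpha * beta.
Let m := mu * beta ^+ 2.

Lemma not_weakly_damped : ~~ weakly_damped mu alpha beta -> m <= a \/ 1 <= a.
Proof.
rewrite /m /a => nw; case: (lerP 1 (alpha * beta)) => h1; first by right.
case: (lerP (mu * beta ^+ 2) (alpha * beta)) => h2; first by left.
move/negP: nw; case; rewrite /weakly_damped in_itv/=.
have ab : alpha < mu * beta by move: h2; rewrite expr2 mulrA ltr_pM2r.
rewrite ltr_pdivrMr// (mulrC beta) ab -[alpha^-1]mul1r ltr_pdivlMr// (mulrC beta).
rewrite h1 !andbT -(@ltr_pXn2r _ 2) ?nnegrE ?sqrtr_ge0 ?(ltW alpha_gt0)//.
rewrite sqr_sqrtr ?(ltW mu_gt0)//.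
have := ltr_pM2l alpha_gt0 alpha (mu * beta); rewrite ab => /esym h3.
have := ltr_pM2l mu_gt0 (alpha * beta) 1; rewrite h1 => /esym; lra.
Qed.

Lemma weakly_dampedP : weakly_damped mu alpha beta -> a < 1 /\ alpha < mu * beta.
Proof.
rewrite /weakly_damped in_itv/= => /and3P[_].
by rewrite ltr_pdivrMr// (mulrC beta) -[alpha^-1]mul1r ltr_pdivlMr// (mulrC beta).
Qed.

(** With [a = alpha * beta] and [m = mu * beta ^+ 2], outside the weakly damped
    regime [beta * R] is the smaller root of
    [z ^+ 2 - (1 + a + m) * z + 2 * m]; with [C = 1 + a - z], the discriminant of
    the dissipation form is a multiple of this polynomial. The square root is taken of a nonnegative
    number in both subcases [m <= a] and [1 <= a]. *)
Lemma rateS_spec : ~~ weakly_damped mu alpha beta ->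
  exists S, [/\ 0 <= S, S ^+ 2 = (1 + a + m) ^+ 2 - 8 * m,
    2 * beta * rateR mu alpha beta = 1 + a + m - S &
    2 * rateC mu alpha beta = 1 + a + S - m].
Proof.
move=> nw; have nd := not_weakly_damped nw.
have m0 : 0 < m by rewrite /m mulr_gt0// exprn_gt0.
have a0 : 0 < a by rewrite mulr_gt0.
pose D := (1 + a + m) ^+ 2 - 8 * m.
have D0 : 0 <= D.
  (* In the two cases [1 + a + m] is at least [1 + 2 * m] and [2 + m], which
     makes [D] at least a perfect square. *)
  rewrite /D; case: nd => h.
    have : 0 <= (a - m) * (2 + a + 3 * m) by rewrite mulr_ge0//; lra.
    have := sqr_ge0 (1 - 2 * m); lra.
  have : 0 <= (a - 1) * (3 + a + 2 * m) by rewrite mulr_ge0//; lra.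
  have := sqr_ge0 (m - 2); lra.
exists (Num.sqrt D); split; first exact: sqrtr_ge0.
- by rewrite sqr_sqrtr.
- rewrite /rateR (negbTE nw) /rateQ.
  rewrite (_ : _ ^+ 2 - _ = D); last by rewrite /D /a /m; ring.
  by rewrite /a /m; field.
- rewrite /rateC (negbTE nw) /rateQ.
  rewrite (_ : _ ^+ 2 - _ = D); last by rewrite /D /a /m; ring.
  by rewrite /a /m; field.
Qed.

Lemma rateR_gt0 : 0 < rateR mu alpha beta.
Proof.
have m0 : 0 < m by rewrite /m mulr_gt0// exprn_gt0.
have a0 : 0 < a by rewrite mulr_gt0.
have [wd|/rateS_spec[S [S0 S2 RE _]]] := boolP (weakly_damped mu alpha beta).
  by rewrite /rateR wd mulr_gt0.
have : 0 < 2 * beta * rateR mu alpha beta.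
  by rewrite RE; nra.
by rewrite pmulr_rgt0// mulr_gt0.
Qed.

Lemma rateC_ge0 : 0 <= rateC mu alpha beta.
Proof.
have m0 : 0 < m by rewrite /m mulr_gt0// exprn_gt0.
have a0 : 0 < a by rewrite mulr_gt0.
have [wd|nw] := boolP (weakly_damped mu alpha beta).
  by rewrite /rateC wd subr_ge0 ltW//; case: (weakly_dampedP wd).
have [S [S0 S2 _ CE]] := rateS_spec nw.
rewrite -(@pmulr_rge0 _ 2)// CE.
by case: (not_weakly_damped nw) => ?; nra.
Qed.

(** [C = 0] makes the square root equal to [m - 1 - a]; comparing squares leaves
    [m * (a - 1) = 0]. *)
Lemma rateC_eq0 : rateC mu alpha beta = 0 ->
  [/\ a = 1, rateR mu alpha beta = 2 * alpha & 2 <= m].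
Proof.
have m0 : 0 < m by rewrite /m mulr_gt0// exprn_gt0.
have a0 : 0 < a by rewrite mulr_gt0.
have [wd|nw] := boolP (weakly_damped mu alpha beta).
  rewrite /rateC wd => C0; have [+ _] := weakly_dampedP wd.
  by rewrite /a; lra.
have [S [S0 S2 RE CE]] := rateS_spec nw => C0.
rewrite C0 mulr0 in CE.
have SE : S = m - 1 - a by lra.
have a1 : a = 1.
  have : m * (a - 1) = 0 by move: S2; rewrite SE; nra.
  by move/eqP; rewrite mulf_eq0 gt_eqF//= => /eqP; lra.
split => //; last by lra.
apply: (@mulfI _ (2 * beta)); first by rewrite mulf_neq0// gt_eqF.
by rewrite RE; move: SE a1; rewrite /a; lra.
Qed.

(** The dissipation form at the rates [C] and [R] is nonnegative: its
    off-diagonal coefficient vanishes in the weakly damped regime, and its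
    discriminant vanishes otherwise. *)
Lemma rate_form_ge0 p r s : 0 <= p -> 0 <= r -> s ^+ 2 <= p * r ->
  let C := rateC mu alpha beta in let Rt := rateR mu alpha beta in
  (C - (1 - alpha * beta)) * s <=
    C * (beta - Rt / (2 * mu)) * p + (alpha - Rt / 2) * r.
Proof.
move=> p0 r0 spr /=.
have m0 : 0 < m by rewrite /m mulr_gt0// exprn_gt0.
have a0 : 0 < a by rewrite mulr_gt0.
have C0 := rateC_ge0.
have [wd|nw] := boolP (weakly_damped mu alpha beta).
  have [a1 am] := weakly_dampedP wd.
  rewrite /rateC /rateR wd subrr mul0r.
  rewrite (_ : alpha - _ = 0) ?mul0r ?addr0; last by field.
  rewrite mulr_ge0// mulr_ge0 ?subr_ge0 ?(ltW a1)//.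
  by rewrite -mulf_div divff// mul1r ler_pdivrMr// mulrC ltW.
have [S [S0 S2 RE CE]] := rateS_spec nw.
set C := rateC _ _ _ in C0 CE *; set Rt := rateR _ _ _ in RE *.
have nd := not_weakly_damped nw.
apply: form_ge0 => //.
- apply: mulr_ge0 => //; rewrite subr_ge0 ler_pdivrMr ?mulr_gt0//.
  rewrite -(@ler_pM2l _ (2 * beta)) ?mulr_gt0// RE.
  suff : 1 + a - 3 * m <= S by rewrite /m /a; nra.
  by case: nd => ?; nra.
- rewrite subr_ge0 ler_pdivrMr//.
  rewrite -(@ler_pM2l _ (2 * beta)) ?mulr_gt0// RE.
  suff : 1 + m - 3 * a <= S by rewrite /m /a; nra.
  by case: nd => ?; nra.
- (* In terms of [a], [m] and [S] the off-diagonal coefficient is [T / 2]; [key]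
     is the vanishing of the discriminant after division by [T]. *)
  have muE : mu = m / beta ^+ 2 by rewrite /m; field.
  have alE : alpha = a / beta by rewrite /a; field.
  have RtE : Rt = (1 + a + m - S) / (2 * beta) by rewrite -RE; field.
  have CE' : C = (1 + a + S - m) / 2 by rewrite -CE; field.
  pose T := 3 * a - 1 - m + S; have mN : m != 0 by rewrite gt_eqF.
  have key : (1 + a + S - m) * (3 * m - 1 - a + S) = 2 * m * T.
    apply/eqP; rewrite -subr_eq0; apply/eqP.
    transitivity (S ^+ 2 - ((1 + a + m) ^+ 2 - 8 * m)); first by rewrite /T; ring.
    by rewrite S2 subrr.
  rewrite muE alE RtE CE' [X in _ <= X](_ : _ =
      T / (8 * m) * ((1 + a + S - m) * (3 * m - 1 - a + S))).
    rewrite key le_eqVlt; apply/orP; left; apply/eqP; rewrite /T.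
    by field; rewrite mN.
  by rewrite /T; field; rewrite mN.
Qed.

(** Lowering the rate from [R] to [Rt] adds the definite form
    [(R - Rt) * (p / (2 * mu) + r / (2 * C))] to the semidefinite one, if the
    weight is [M = C^-1]. When [C = 0] the product [alpha * beta] is [1], the
    off-diagonal coefficient no longer grows with [M], and a large [M] works. *)
Lemma strict_dissipation Rt : 0 <= Rt -> Rt < rateR mu alpha beta ->
  exists M c, [/\ 0 < M, 0 < c & forall p r s, 0 <= p -> 0 <= r ->
    s ^+ 2 <= p * r ->
    (1 - M * (1 - alpha * beta)) * s - (beta - Rt / (2 * mu)) * p
      - M * (alpha - Rt / 2) * r <= - c * (p + r)].
Proof.
move=> Rt0 RtR; have d0 : 0 < rateR mu alpha beta - Rt by rewrite subr_gt0.
suff [M [c1 [c2 [M0 c10 c20 h]]]] : exists M c1 c2, [/\ 0 < M, 0 < c1, 0 < c2 &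
    forall p r s, 0 <= p -> 0 <= r -> s ^+ 2 <= p * r ->
    (1 - M * (1 - alpha * beta)) * s - (beta - Rt / (2 * mu)) * p
      - M * (alpha - Rt / 2) * r <= - (c1 * p + c2 * r)].
  exists M, (Num.min c1 c2); split => // [|p r s p0 r0 spr].
    by rewrite lt_min c10.
  apply: le_trans (h p r s p0 r0 spr) _.
  have : Num.min c1 c2 <= c1 by rewrite ge_min lexx.
  have : Num.min c1 c2 <= c2 by rewrite ge_min lexx orbT.
  nra.
have := rateC_ge0; rewrite le_eqVlt => /predU1P[/esym C0|C0].
  have [a1 RE m2] := rateC_eq0 C0.
  (* The weight is chosen so that [M * (alpha - Rt / 2) = 1 + beta^-1]: the part
     [beta^-1] absorbs the cross term and [1] remains. *)
  exists (2 * (1 + beta^-1) / (rateR mu alpha beta - Rt)), (beta / 4), 1.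
  have bV : 0 < beta^-1 by rewrite invr_gt0.
  split; [by rewrite divr_gt0// mulr_gt0// addr_gt0| by rewrite divr_gt0 | by []|].
  move=> p r s p0 r0 spr.
  have : 1 * s <= beta / 4 * p + beta^-1 * r.
    apply: form_ge0 => //; [by rewrite divr_ge0// (ltW beta_gt0) | exact: ltW bV |].
    have -> : 4 * (beta / 4) * beta^-1 = 1 by field.
    by rewrite expr1n.
  have -> : 1 - alpha * beta = 0 by move: a1; rewrite /a; lra.
  set K := 2 * (1 + beta^-1) / _.
  have -> : K * (alpha - Rt / 2) = 1 + beta^-1.
    by rewrite /K RE; field; move: d0; rewrite RE => /gt_eqF ->; rewrite beta_neq0.
  have : Rt / (2 * mu) <= beta / 2.
    rewrite ler_pdivrMr ?mulr_gt0//; move: RtR m2 a1; rewrite RE /m /a => h1 h2 h3.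
    rewrite -(ler_pM2l beta_gt0); nra.
  rewrite mulr0 subr0; nra.
set C := rateC _ _ _ in C0 *; set Rr := rateR _ _ _ in RtR d0 *.
have CN : C != 0 by rewrite gt_eqF.
exists C^-1, ((Rr - Rt) / (2 * mu)), ((Rr - Rt) / (2 * C)).
split; rewrite ?invr_gt0 ?divr_gt0 ?mulr_gt0// => p r s p0 r0 spr.
have := rate_form_ge0 p0 r0 spr; rewrite /= -/C -/Rr.
rewrite -(ler_pM2l (_ : 0 < C^-1)) ?invr_gt0// -subr_ge0 => h.
rewrite -subr_ge0; apply: le_trans h _; rewrite le_eqVlt; apply/orP; left; apply/eqP.
by field; rewrite CN.
Qed.

End Fixed.
End Rates.

(** * Exponentially decaying functions *)

Section ExponentialDecay.
Context (R : realType).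
Implicit Types (g : R -> R) (a r K T t : R).

(** On the compact interval [`[a, T]] the ratio of the two sides is bounded. *)
Lemma exp_bound_extend g a r K T :
  {within `[a, +oo[, continuous g} ->
  (forall t, T <= t -> g t <= K * expR (- r * t)) ->
  exists2 K', 0 <= K' & forall t, a <= t -> g t <= K' * expR (- r * t).
Proof.
move=> gc gK; have K0 : 0 <= Num.max K 0 by rewrite le_max lexx orbT.
have [Ta|aT] := ltP T a.
  exists (Num.max K 0) => // t at_; apply: le_trans (gK t _) _.
    by rewrite (le_trans (ltW Ta)).
  by rewrite ler_wpM2r ?expR_ge0// le_max lexx.
pose G t := g t * expR (r * t).
have Gc : {within `[a, T], continuous G}.
  move=> u; rewrite /continuous_at; apply: cvgM.
    exact: (continuous_subspaceW (subset_itvl _) gc).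
  apply: continuous_subspaceT => {}u; apply: continuous_comp.
    by apply: continuousM; [exact: cst_continuous|exact: cvg_id].
  exact: continuous_expR.
have [c _ cmax] := EVT_max aT Gc.
exists (Num.max (Num.max K 0) (G c)); first by rewrite le_max K0.
move=> t at_; have [tT|Tt] := leP t T.
  have := cmax t; rewrite in_itv/= at_ tT => /(_ isT) GG.
  rewrite mulNr expRN ler_pdivlMr ?expR_gt0//.
  by rewrite (le_trans GG)// le_max lexx orbT.
apply: le_trans (gK t (ltW Tt)) _.
by rewrite ler_wpM2r ?expR_ge0// !le_max lexx.
Qed.

(** The dominating function is a multiple of the density of an exponential
    distribution, which has integral [1]. *)
Lemma integral_exp_bounded g a r K : 0 <= a -> 0 < r -> 0 <= K ->
  {within `[a, +oo[, continuous g} ->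
  (forall t, a <= t -> 0 <= g t <= K * expR (- r * t)) ->
  (\int[lebesgue_measure]_(t in `[a, +oo[) (g t)%:E < +oo)%E.
Proof.
move=> a0 r0 K0 gc gK.
have mA : measurable (`[a, +oo[ : set R) by exact: measurable_itv.
have mp : measurable_fun setT (EFin \o exponential_pdf r).
  by apply/measurable_EFinP; exact: measurable_exponential_pdf.
have mpA : measurable_fun (`[a, +oo[ : set R) (EFin \o exponential_pdf r).
  exact: measurable_funTS.
have p0 t : (0 <= (exponential_pdf r t)%:E)%E.
  by rewrite lee_fin exponential_pdf_ge0// ltW.
have Kr0 : 0 <= K / r by rewrite divr_ge0// ltW.
apply: (@le_lt_trans _ _ (\int[lebesgue_measure]_(t in `[a, +oo[)
    ((K / r)%:E * (exponential_pdf r t)%:E))%E).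
  apply: ge0_le_integral => //.
  - by move=> t; rewrite /= in_itv/= andbT lee_fin => /gK/andP[].
  - apply/measurable_EFinP; exact: subspace_continuous_measurable_fun.
  - exact: measurable_funeM.
  - move=> t; rewrite /= in_itv/= andbT -EFinM lee_fin => at_.
    have /andP[_ /le_trans] := gK t at_; apply.
    rewrite exponential_pdfE ?(le_trans a0)//.
    by rewrite mulrA divfK// gt_eqF.
rewrite ge0_integralZl//.
apply: (@le_lt_trans _ _ ((K / r)%:E * 1)%E); last by rewrite mule1 ltry.
rewrite lee_wpmul2l ?lee_fin//.
by rewrite -(integral_exponential_pdf r0); exact: ge0_subset_integral.
Qed.

Lemma sqr_exp_littleo g a d K T : 0 < d ->
  (forall t, T <= t -> 0 <= g t) ->
  (forall t, T <= t -> g t ^+ 2 <= K * expR (- (2 * a + d) * t)) ->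
  g =o_+oo (fun t => expR (- a * t)).
Proof.
move=> d0 g0 gK; apply/eqoP => e e0.
pose B := Num.max K 1 / e ^+ 2.
near=> t.
have tT : T <= t by [].
have dt : B <= expR (d * t).
  apply: le_trans (expR_ge1Dx _); apply: (@le_trans _ _ (d * t)); last first.
    by rewrite lerDr.
  by rewrite mulrC -ler_pdivrMr//.
rewrite ger0_norm ?g0// ger0_norm ?expR_ge0//.
rewrite -(@ler_pXn2r _ 2) ?nnegrE ?g0// ?mulr_ge0 ?expR_ge0 ?(ltW e0)//.
apply: le_trans (gK t tT) _.
rewrite exprMn -expRM_natl.
have -> : - (2 * a + d) * t = 2%:R * (- a * t) - d * t by ring.
rewrite expRD expRN mulrCA mulrC ler_wpM2r ?expR_ge0//.
rewrite ler_pdivrMr ?expR_gt0// mulrC -ler_pdivrMr ?exprn_gt0//.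
by apply: le_trans dt; rewrite ler_pM2r ?invr_gt0 ?exprn_gt0// le_max lexx.
Unshelve. all: by end_near.
Qed.

End ExponentialDecay.

(** * Lyapunov analysis of the trajectory *)

Section Dynamics.
Context (R : realType) (H : completeNormedModType R) (ip : {dot H for idfun}).
Context (ip_norm : hilbert_norm ip) (F : H -> R).
Context (F_C2 : twice_continuously_differentiable ip F).
Context (alpha beta : R) (alpha_gt0 : 0 < alpha) (beta_gt0 : 0 < beta).
Context (x : R -> H) (x_sol : is_solution ip F alpha beta x).
Context (xbar : H) (mu : R) (mu_gt0 : 0 < mu) (t0 : R) (t0_gt0 : 0 < t0).
Context (loj : forall t, t0 <= t ->
  F (x t) - F xbar <= (2 * mu)^-1 * `|grad ip F (x t)| ^+ 2).

Implicit Types t M : R.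
Let v := halfline_derive x.
Let w t := grad ip F (x t).
Let y t := beta *: w t + v t.
Let V t := F (x t) - F xbar.

Lemma is_derive_x t : 0 < t -> is_derive t 1 x (v t).
Proof.
move=> t_gt0; case: x_sol => -[x1 _ _] _.
exact: halfline_is_derive (x1 _ (ltW t_gt0)).
Qed.

Lemma is_derive_V t : 0 < t -> is_derive t 1 V (ip (w t) (v t)).
Proof.
move=> t_gt0; have [dF _ _] := F_C2.
have dV := is_derive_along (dF _) (is_derive_x t_gt0).
rewrite (_ : V = F \o x - cst (F xbar)) //.
apply: is_derive_eq; rewrite subr0; exact: ip_grad.
Qed.

Lemma is_derive_w t : 0 < t -> is_derive t 1 w (hessian ip F (x t) (v t)).
Proof.
move=> t_gt0; have [_ dG _] := F_C2.
exact: is_derive_along (dG _) (is_derive_x t_gt0).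
Qed.

(** The Hessian term in the derivative of [beta *: w] cancels the one in the
    equation for [x'']. *)
Lemma is_derive_y t : 0 < t ->
  is_derive t 1 y (- alpha *: y t - (1 - alpha * beta) *: w t).
Proof.
move=> t_gt0; case: x_sol => -[_ x2 _] /(_ t (ltW t_gt0)) ode.
have dw := is_derive_w t_gt0.
have dv := halfline_is_derive t_gt0 (x2 _ (ltW t_gt0)).
rewrite (_ : y = beta \*: w + v) //.
apply: is_derive_eq; move/eqP: ode; rewrite -!addrA addr_eq0 => /eqP ->.
rewrite addrCA opprD addNKr scalerDr scalerA scalerBl scale1r mulNr !scaleNr.
by rewrite opprB addrACA addNr add0r opprD.
Qed.

Let energy M t := V t + M / 2 * `|y t| ^+ 2.

Lemma is_derive_energy M t : 0 < t -> is_derive t 1 (energy M)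
  ((1 - M * (1 - alpha * beta)) * ip (w t) (y t) - beta * `|w t| ^+ 2
     - M * alpha * `|y t| ^+ 2).
Proof.
move=> t_gt0; have dV := is_derive_V t_gt0.
have dy := is_derive_norm_sqr ip_norm (is_derive_y t_gt0).
rewrite (_ : energy M = V + (M / 2) \*: (fun s => `|y s| ^+ 2)) //.
apply: is_derive_eq.
have -> : ip (w t) (v t) = ip (w t) (y t) - beta * `|w t| ^+ 2.
  by rewrite /y ipDr ipZr ip_norm; ring.
have -> : ip (y t) (- alpha *: y t - (1 - alpha * beta) *: w t) =
    - alpha * `|y t| ^+ 2 - (1 - alpha * beta) * ip (w t) (y t).
  by rewrite ipDr ipNr !ipZr ip_norm (ipC _ (y t) (w t)).
by rewrite /GRing.scale/=; field.
Qed.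

Let C := rateC mu alpha beta.
Let Rt := rateR mu alpha beta.
Let Rt_gt0 : 0 < Rt. Proof. exact: rateR_gt0. Qed.

Let V_le t : t0 <= t -> V t <= `|w t| ^+ 2 / (2 * mu).
Proof. by move=> /loj; rewrite mulrC. Qed.

(** The energy with weight [M = C^-1] dominates [V], and its decay at the rate
    [R] is [rate_form_ge0] divided by [C]. *)
Lemma potential_decay t : 0 < C -> t0 <= t ->
  V t <= (V t0 + (2 * C)^-1 * `|y t0| ^+ 2) * expR (- Rt * (t - t0)).
Proof.
move=> C_gt0 tt0; have C_neq0 : C != 0 by rewrite gt_eqF.
have -> : V t0 + (2 * C)^-1 * `|y t0| ^+ 2 = energy C^-1 t0.
  by rewrite /energy; field.
apply: (@le_trans _ _ (energy C^-1 t)).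
  by rewrite /energy lerDl mulr_ge0 ?divr_ge0 ?invr_ge0 ?exprn_ge0 ?(ltW C_gt0).
apply: gronwall_decay tt0 => s ts.
  exact/is_derive_energy/(lt_le_trans t0_gt0).
have := rate_form_ge0 mu_gt0 alpha_gt0 beta_gt0 (exprn_ge0 2 (normr_ge0 (w s)))
  (exprn_ge0 2 (normr_ge0 (y s))) (ip_sqr_le ip_norm (w s) (y s)).
rewrite /= -/C -/Rt -(ler_pM2l (_ : 0 < C^-1)) ?invr_gt0// => form.
have RV : Rt * V s <= Rt * (`|w s| ^+ 2 / (2 * mu)).
  by rewrite ler_wpM2l ?(ltW Rt_gt0)// V_le.
rewrite -subr_le0 in form.
apply: le_trans form; rewrite /energy.
rewrite -subr_ge0.
apply: (@le_trans _ _ (Rt * (`|w s| ^+ 2 / (2 * mu)) - Rt * V s)).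
  by rewrite subr_ge0.
by rewrite le_eqVlt; apply/orP; left; apply/eqP; field; rewrite C_neq0 gt_eqF.
Qed.

(** When [C = 0] one has [alpha * beta = 1], so [y] solves [y' = - alpha *: y]
    and stays zero; the trajectory is then a gradient flow. *)
Lemma potential_decay0 t : C = 0 -> y t0 = 0 -> t0 <= t ->
  V t <= V t0 * expR (- Rt * (t - t0)).
Proof.
move=> C0 y0 tt0; have [ab RE mub] := rateC_eq0 mu_gt0 alpha_gt0 beta_gt0 C0.
have ys s : t0 <= s -> y s = 0.
  move=> ts; apply/eqP; rewrite -normr_eq0 -sqrf_eq0 eq_le sqr_ge0 andbT.
  pose dy u := 2 * ip (y u) (- alpha *: y u - (1 - alpha * beta) *: w u).
  have := @gronwall_decay _ (fun s => `|y s| ^+ 2) dy (2 * alpha) t0 _ _ s ts.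
  rewrite y0 normr0 expr0n mul0r; apply=> u tu.
    exact/is_derive_norm_sqr/is_derive_y/(lt_le_trans t0_gt0).
  by rewrite /dy ab subrr scale0r subr0 ipZr ip_norm; lra.
apply: (gronwall_decay (dE := fun s => ip (w s) (v s))) tt0 => s ts.
  exact/is_derive_V/(lt_le_trans t0_gt0).
have -> : v s = - beta *: w s.
  by apply/eqP; rewrite scaleNr -addr_eq0 addrC; apply/eqP; exact: ys.
rewrite ipZr -ip_norm.
have : Rt * V s <= Rt * (`|w s| ^+ 2 / (2 * mu)).
  by rewrite ler_wpM2l ?(ltW Rt_gt0)// V_le.
have : Rt / (2 * mu) <= beta.
  rewrite ler_pdivrMr ?mulr_gt0// /Rt RE -(ler_pM2l beta_gt0); nra.
have := sqr_ge0 `|w s|; set p := _ ^+ 2 => p0 h1 h2.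
have := ler_wpM2r p0 h1; lra.
Qed.

(** Adding a small multiple of [`|w| ^+ 2] to the energy gives a Lyapunov
    function that controls the gradient itself: its derivative is absorbed by the
    strict dissipation because the Hessian is bounded near [xbar]. *)
Lemma gradient_decay r : x t @[t --> +oo] --> xbar ->
  (forall t, t0 <= t -> F xbar <= F (x t)) -> 0 <= r -> r < Rt ->
  exists K T, forall t, T <= t -> `|w t| ^+ 2 <= K * expR (- r * t).
Proof.
move=> x_lim V_ge0 r0 rR.
have [M [c [M0 c0 diss]]] := strict_dissipation mu_gt0 alpha_gt0 beta_gt0 r0 rR.
have [L [L0 hL]] := hessian_bounded_near xbar F_C2.
have [T [Tt0 hT]] : exists T, t0 <= T /\ forall t, T <= t ->
    forall h, `|hessian ip F (x t) h| <= L * `|h|.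
  have [T0 [_ hT0]] := x_lim _ hL.
  exists (Num.max t0 (T0 + 1)); split; first by rewrite le_max lexx.
  move=> t; rewrite ge_max => /andP[_ Tt]; apply: hT0.
  by apply: lt_le_trans Tt; rewrite ltrDl.
(* [N * (`|w| ^+ 2 + `|y| ^+ 2)] bounds the derivative of [`|w| ^+ 2] plus
   [r * `|w| ^+ 2], so the weight [k = c / N] uses up the strict dissipation. *)
pose N := L * (1 + 2 * beta) + r + 1.
have N0 : 0 < N.
  by rewrite /N ltr_wpDl// addr_ge0// mulr_ge0// addr_ge0// mulr_ge0// ltW.
pose k := c / N.
have k0 : 0 < k by rewrite divr_gt0.
pose Psi t := k * `|w t| ^+ 2 + energy M t.
have E0 t : t0 <= t -> 0 <= energy M t.
  move=> /V_ge0 Vt; rewrite addr_ge0 ?subr_ge0// mulr_ge0 ?exprn_ge0//.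
  by rewrite divr_ge0// ltW.
have decay t : T <= t -> Psi t <= Psi T * expR (- r * (t - T)).
  pose dPsi s := k * (2 * ip (w s) (hessian ip F (x s) (v s)))
    + ((1 - M * (1 - alpha * beta)) * ip (w s) (y s) - beta * `|w s| ^+ 2
       - M * alpha * `|y s| ^+ 2).
  apply: (gronwall_decay (dE := dPsi)) => s Ts; have ts := le_trans Tt0 Ts.
    have s0 := lt_le_trans t0_gt0 ts.
    have dE := is_derive_energy M s0.
    have dw := is_derive_norm_sqr ip_norm (is_derive_w s0).
    exact: is_deriveD (is_deriveZ k dw) dE.
  have := diss _ _ _ (exprn_ge0 2 (normr_ge0 (w s)))
    (exprn_ge0 2 (normr_ge0 (y s))) (ip_sqr_le ip_norm (w s) (y s)).
  have rV : r * V s <= r * (`|w s| ^+ 2 / (2 * mu)) by rewrite ler_wpM2l// V_le.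
  have hv : 2 * ip (w s) (hessian ip F (x s) (v s)) <=
      L * (1 + 2 * beta) * (`|w s| ^+ 2 + `|y s| ^+ 2).
    have vy : `|v s| <= `|y s| + beta * `|w s|.
      have := ler_normB (y s) (beta *: w s).
      by rewrite {1}/y addrC addKr normrZ (gtr0_norm beta_gt0).
    have := ip_le_norm ip_norm (w s) (hessian ip F (x s) (v s)).
    have := ler_wpM2l (normr_ge0 (w s)) (hT s Ts (v s)).
    have := ler_wpM2l L0 (ler_wpM2l (normr_ge0 (w s)) vy).
    have := mulr_ge0 L0 (sqr_ge0 (`|w s| - `|y s|)).
    have := mulr_ge0 (mulr_ge0 L0 (ltW beta_gt0)) (sqr_ge0 `|y s|).
    move: (ip _ _) `|hessian _ _ _ _| `|w s| `|y s| `|v s| => i h p q u; nra.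
  have kN : k * N = c by rewrite /k divfK// gt_eqF.
  have := ler_wpM2l (ltW k0) hv.
  rewrite /dPsi /Psi /energy.
  have := sqr_ge0 `|w s|; have := sqr_ge0 `|y s|.
  move: (ip (w s) (y s)) (ip _ _) (`|w s| ^+ 2) (`|y s| ^+ 2) rV hv.
  move: (V s) => U i j p q; rewrite -kN /N.
  move=> rV hv q0 p0 kh dd.
  have kr : 0 <= k * (r * q + (p + q)).
    by rewrite mulr_ge0 ?(ltW k0)// addr_ge0 ?mulr_ge0// addr_ge0.
  lra.
exists (k^-1 * (Psi T * expR (r * T))), T => t Tt.
rewrite -mulrA ler_pdivlMl//; apply: le_trans (_ : Psi t <= _).
  by rewrite /Psi lerDl E0// (le_trans Tt0).
apply: le_trans (decay t Tt) _.
by rewrite (_ : - r * (t - T) = r * T + - r * t) ?expRD ?mulrA//; ring.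
Qed.

Lemma continuous_gradient_along : {within `[t0, +oo[, continuous w}.
Proof.
apply: derivable_within_continuous => t; rewrite in_itv/= andbT => tt0.
by have [] := is_derive_w (lt_le_trans t0_gt0 tt0).
Qed.

End Dynamics.

(** * The convergence rates *)

(* The first bound is stated in \bar R because rateC mu alpha beta can vanish
   (exactly when alpha * beta = 1 and mu * beta ^+ 2 >= 2), in which case
   1 / (2 C) is read as +oo, and +oo * 0 as 0. *)
Theorem theorem1 (R : realType) (H : completeNormedModType R)
    (ip : {dot H for idfun}) (ip_norm : hilbert_norm ip)
    (F : H -> R)
    (F_C2 : twice_continuously_differentiable ip F)
    (F_lb : has_lbound (range F))
    (F_crit : crit ip F !=set0)
    (F_loj : lojasiewicz ip F 2)
    (alpha beta : R) (alpha_gt0 : 0 < alpha) (beta_gt0 : 0 < beta)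
    (x : R -> H) (x_sol : is_solution ip F alpha beta x)
    (xbar : H) (x_lim : x t @[t --> +oo] --> xbar) (xbar_crit : crit ip F xbar)
    (Omega : set H) (Omega_nbhs : nbhs xbar Omega)
    (mu : R) (mu_gt0 : 0 < mu)
    (F_Omega : forall z : H, Omega z ->
       `|F z - F xbar| <= (2 * mu)^-1 * `|grad ip F z| ^+ 2)
    (t0 : R) (t0_gt0 : 0 < t0)
    (x_Omega : forall t : R, t0 <= t -> Omega (x t)) :
  (forall t : R, t0 <= t ->
     ((F (x t) - F xbar)%:E <=
      ((F (x t0) - F xbar)%:E
       + (2 * rateC mu alpha beta)%:E^-1
         * (`|beta *: grad ip F (x t0) + halfline_derive x t0| ^+ 2)%:E)
      * (expR (- rateR mu alpha beta * (t - t0)))%:E)%E)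
  /\
  ((forall t : R, t0 <= t -> F xbar <= F (x t)) ->
   forall eps : R, 0 < eps ->
     (\int[lebesgue_measure]_(t in `[t0, +oo[)
        (expR ((rateR mu alpha beta - eps) * t)
         * `|grad ip F (x t)| ^+ 2)%:E < +oo)%E
     /\
     (fun t : R => `|grad ip F (x t)|) =o_+oo
       (fun t : R => expR (- ((rateR mu alpha beta - eps) / 2) * t))).
Proof.
have loj t : t0 <= t ->
    F (x t) - F xbar <= (2 * mu)^-1 * `|grad ip F (x t)| ^+ 2.
  by move=> /x_Omega/F_Omega; apply: le_trans; exact: ler_norm.
set Rt := rateR mu alpha beta.
split=> [t tt0|V_ge0 eps eps0].
  have := rateC_ge0 mu_gt0 alpha_gt0 beta_gt0; rewrite le_eqVlt => /predU1P[C0|C0].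
    rewrite -C0 mulr0 inve0.
    have [y0|y_neq0] := eqVneq (beta *: grad ip F (x t0) + halfline_derive x t0) 0.
      rewrite y0 normr0 expr0n mule0 adde0 -EFinM lee_fin.
      exact: (potential_decay0 ip_norm F_C2 alpha_gt0 beta_gt0 x_sol mu_gt0
                t0_gt0 loj (esym C0) y0 tt0).
    rewrite gt0_mulye ?lte_fin ?exprn_gt0 ?normr_gt0// addey//.
    by rewrite gt0_mulye ?lte_fin ?expR_gt0// leey.
  rewrite inver [_ == 0]gt_eqF ?mulr_gt0// -EFinM lee_fin.
  exact: (potential_decay ip_norm F_C2 alpha_gt0 beta_gt0 x_sol mu_gt0
            t0_gt0 loj C0 tt0).
(* The rate [R - eps / 2] leaves a factor [exp (- eps / 2 * t)] to spare; the
   maximum with [0] is there because the decay estimate needs a rate >= 0. *)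
have [K [T [K0 Tt0 wK]]] : exists K T, [/\ 0 <= K, t0 <= T & forall t, T <= t ->
    `|grad ip F (x t)| ^+ 2 <= K * expR (- (Rt - eps / 2) * t)].
  have RtR : Num.max (Rt - eps / 2) 0 < Rt.
    by rewrite gt_max rateR_gt0// gtrBl divr_gt0.
  have r0 : 0 <= Num.max (Rt - eps / 2) 0 by rewrite le_max lexx orbT.
  have [K [T wK]] := gradient_decay ip_norm F_C2 alpha_gt0 beta_gt0 x_sol mu_gt0
    t0_gt0 loj x_lim V_ge0 r0 RtR.
  exists (Num.max K 0), (Num.max T t0); split; rewrite ?le_max ?lexx ?orbT//.
  move=> t; rewrite ge_max => /andP[Tt tt0]; apply: le_trans (wK t Tt) _.
  have t_ge0 : 0 <= t by rewrite (le_trans (ltW t0_gt0)).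
  have er : expR (- Num.max (Rt - eps / 2) 0 * t) <= expR (- (Rt - eps / 2) * t).
    by rewrite ler_expR ler_wpM2r// lerN2 le_max lexx.
  apply: (@le_trans _ _ (Num.max K 0 * expR (- Num.max (Rt - eps / 2) 0 * t))).
    by rewrite ler_wpM2r ?expR_ge0// le_max lexx.
  by rewrite ler_wpM2l// le_max lexx orbT.
split; last first.
  apply: (@sqr_exp_littleo _ _ _ (eps / 2) K T); first by rewrite divr_gt0.
    by move=> t _; exact: normr_ge0.
  move=> t Tt; apply: le_trans (wK t Tt) _.
  by rewrite (_ : 2 * _ + _ = Rt - eps / 2)//; field.
pose g t := expR ((Rt - eps) * t) * `|grad ip F (x t)| ^+ 2.
have gc : {within `[t0, +oo[, continuous g}.
  have wc := continuous_gradient_along F_C2 x_sol t0_gt0.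
  have -> : g = fun t => expR ((Rt - eps) * t) *
      (`|grad ip F (x t)| * `|grad ip F (x t)|) by apply/funext => t; rewrite -expr2.
  move=> t; rewrite /continuous_at; apply: cvgM.
    apply: continuous_subspaceT => {}t; apply: continuous_comp.
      by apply: continuousM; [exact: cst_continuous|exact: cvg_id].
    exact: continuous_expR.
  by apply: cvgM; apply: cvg_norm; exact: wc.
have gK t : T <= t -> g t <= K * expR (- (eps / 2) * t).
  move=> Tt.
  have -> : - (eps / 2) * t = (Rt - eps) * t + - (Rt - eps / 2) * t by field.
  by rewrite expRD mulrCA ler_wpM2l ?expR_ge0// wK.
have [K' K'0 gK'] := exp_bound_extend gc gK.
have eps2 : 0 < eps / 2 by rewrite divr_gt0.
apply: (integral_exp_bounded (ltW t0_gt0) eps2 K'0 gc).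
by move=> t tt0; apply/andP; split; [rewrite mulr_ge0 ?expR_ge0|exact: gK'].
Qed.
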